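(* Let $F_1,F_2$ be two conic Finsler metrics on a manifold $M$ defined on a common conic domain $A_0$, with fundamental tensors $g^1,g^2$ and angular metrics $h^1,h^2$. Let $I\subset\mathbb R$ be open and $\phi:I\to\mathbb R$, $\phi>0$, a smooth function; put $\psi=\phi^2$, $\varphi_1(s)=2\psi(s)-s\dot\psi(s)$ and $\varphi_2=2\psi\ddot\psi-\dot\psi^2$. Define the conic pseudo-Finsler metric $$F(v)=F_1(v)\,\phi\Big(\frac{F_2(v)}{F_1(v)}\Big)$$ on $A=\{v\in A_0:F_2(v)/F_1(v)\in I\}$ (assumed to satisfy $\pi(A)=M$), with the convention that, for each $p\in M$, $0_p\in A_p=A\cap T_pM$ if and only if $T_pM\setminus\{0_p\}\subset A_p$. The fundamental tensor $g$ of $F$ is given by $$2g_v(w,w)=\varphi_1(s)h^1_v(w,w)+\frac{F_1(v)}{F_2(v)}\dot\psi(s)h^2_v(w,w)+\frac{\varphi_2(s)}{2\psi(s)}\Big(\frac{F_2(v)}{F_1(v)^2}g^1_v(v,w)-\frac{g^2_v(v,w)}{F_2(v)}\Big)^2$$ $$+\frac1{2\psi(s)}\Big(\varphi_1(s)\frac{g^1_v(v,w)}{F_1(v)}+\dot\psi(s)\frac{g^2_v(v,w)}{F_2(v)}\Big)^2,\qquad s=\frac{F_2(v)}{F_1(v)},$$ for any $v\in A\setminus0$ and $w\in T_{\pi(v)}M$. Moreover, $F$ is a conic Finsler metric on $A$ if $\dot\psi\ge0$, $\varphi_1>0$ and $\varphi_2\ge0$.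
   Context: Let $\pi:TM\to M$ be the natural projection. A conic pseudo-Finsler metric on $M$ with domain $A$ is a continuous function $F:A\to[0,\infty)$, where $A\subset TM$ is open with $\pi(A)=M$ and conic ($v\in A$, $\lambda>0$ imply $\lambda v\in A$), which is smooth on $A$ except at most at the zero vectors, with $F(v)=0$ iff $v$ is a zero vector (so $F(0_p)=0$ when $0_p\in A$) and $F(\lambda v)=\lambda F(v)$ for $\lambda>0$, $v\in A$. Its fundamental tensor is $g_v(u,w)=\frac12\frac{\partial^2}{\partial t\partial s}F(v+tu+sw)^2|_{t=s=0}$ for $v\in A\setminus0$ (nonzero vectors of $A$), $u,w\in T_{\pi(v)}M$. It is a conic Finsler metric if $g_v$ is positive definite for all $v\in A\setminus0$. The angular metric of $F_k$ is $h^k_v(w,w)=g^k_v(w,w)-\frac1{F_k(v)^2}g^k_v(v,w)^2$. Dots denote derivatives of functions of one real variable. *)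

(* Defs.v *)
From HB Require Import structures.
From mathcomp Require Import all_boot all_order all_algebra.
From mathcomp Require Import all_classical all_reals all_analysis.

Set Implicit Arguments.
Unset Strict Implicit.
Unset Printing Implicit Defensive.

Import Order.TTheory GRing.Theory Num.Theory.
Import numFieldNormedType.Exports.

Local Open Scope classical_set_scope.
Local Open Scope ring_scope.

(* C^oo regularity on an open set [U] of a finite-dimensional space: all
   iterated directional derivatives of [f] are (totally) differentiable on
   [U]. *)
Definition smooth_on (R : realType) (V W : normedModType R) (U : set V)
    (f : V -> W) : Prop :=
  forall (vs : seq V) (x : V), U x ->
    differentiable (foldr (fun v g => 'D_v g) f vs) x.

Record chart (R : realType) (n : nat) (M : topologicalType) := Chart {
  chart_dom : set M;
  chart_cod : set 'rV[R]_n;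
  chart_map : M -> 'rV[R]_n;
  chart_inv : 'rV[R]_n -> M;
  chart_open_dom : open chart_dom;
  chart_open_cod : open chart_cod;
  chart_mapP : forall p, chart_dom p -> chart_cod (chart_map p);
  chart_invP : forall x, chart_cod x -> chart_dom (chart_inv x);
  chart_mapK : forall p, chart_dom p -> chart_inv (chart_map p) = p;
  chart_invK : forall x, chart_cod x -> chart_map (chart_inv x) = x;
  chart_map_continuous : {in chart_dom, continuous chart_map};
  chart_inv_continuous : {in chart_cod, continuous chart_inv}
}.

Record smooth_manifold (R : realType) (n : nat) := SmoothManifold {
  manifold_carrier :> topologicalType;
  manifold_hausdorff : hausdorff_space manifold_carrier;
  manifold_second_countable : @second_countable manifold_carrier;
  atlas : set (chart R n manifold_carrier);
  atlas_cover : forall p : manifold_carrier,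
    exists2 c, atlas c & chart_dom c p;
  atlas_smooth : forall c d, atlas c -> atlas d ->
    smooth_on [set x | chart_cod c x /\ chart_dom d (chart_inv c x)]
              (chart_map d \o chart_inv c)
}.

(* A chart of the atlas around [p], fixed once and for all by choice. *)
Definition chart_at (R : realType) (n : nat) (M : smooth_manifold R n)
    (p : M) : chart R n M :=
  s2val (cid2 (atlas_cover p)).

(* [Tangent p v] is the vector of T_pM with coordinates [v] in the chart
   [chart_at p]: this identifies T_pM with R^n as a vector space.  As
   [chart_at p] may jump with [p], the topology and the smooth structure of TM
   are not those of the product M x R^n; see [tangent_param]. *)
Record tangent_bundle (R : realType) (n : nat) (M : smooth_manifold R n) :=
  Tangent { base : M; vec : 'rV[R]_n }.

Arguments Tangent {R n M} base vec.

(* Inverse of the bundle chart T(dom c) -> cod c x R^n induced by [c]: the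
   vector with coordinates z.2 in [c] at the point p = c^-1(z.1), whose
   coordinates in [chart_at p] are obtained with the differential of the
   transition map. *)
Definition tangent_param (R : realType) (n : nat) (M : smooth_manifold R n)
    (c : chart R n M) (z : 'rV[R]_n * 'rV[R]_n) : tangent_bundle M :=
  let p := chart_inv c z.1 in
  Tangent p ('d (chart_map (chart_at p) \o chart_inv c) (z.1) (z.2)).

Definition tangent_preim (R : realType) (n : nat) (M : smooth_manifold R n)
    (c : chart R n M) (B : set (tangent_bundle M)) :
    set ('rV[R]_n * 'rV[R]_n) :=
  [set z | chart_cod c z.1 /\ B (tangent_param c z)].

Section TangentTopology.
Context (R : realType) (n : nat) (M : smooth_manifold R n).

Definition tangent_open (B : set (tangent_bundle M)) : Prop :=
  forall c, atlas c -> open (tangent_preim c B).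

Lemma tangent_openT : tangent_open setT.
Proof.
move=> c _; rewrite (_ : tangent_preim c setT = fst @^-1` chart_cod c).
  by apply: open_comp => [z _|]; [exact: cvg_fst|exact: chart_open_cod].
by apply/seteqP; split => z //= -[].
Qed.

Lemma tangent_openI : setI_closed tangent_open.
Proof.
move=> B C oB oC c ac.
rewrite (_ : tangent_preim c _ = tangent_preim c B `&` tangent_preim c C).
  by apply: openI; [exact: oB|exact: oC].
by apply/seteqP; split => z; rewrite /tangent_preim /=; tauto.
Qed.

Lemma tangent_open_bigU (J : Type) (f : J -> set (tangent_bundle M)) :
  (forall i, tangent_open (f i)) -> tangent_open (\bigcup_i f i).
Proof.
move=> of_ c ac.
rewrite (_ : tangent_preim c _ = \bigcup_i tangent_preim c (f i)).
  by apply: bigcup_open => i _; exact: of_.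
apply/seteqP; split => z /=; first by move=> [cz [i _ fz]]; exists i.
by move=> [i _ [cz fz]]; split=> //; exists i.
Qed.

HB.instance Definition _ := gen_eqMixin (tangent_bundle M).
HB.instance Definition _ := gen_choiceMixin (tangent_bundle M).
HB.instance Definition _ := isOpenTopological.Build (tangent_bundle M)
  tangent_openT tangent_openI tangent_open_bigU.

End TangentTopology.

Section ConicFinsler.
Context (R : realType) (n : nat) (M : smooth_manifold R n).
Local Notation TM := (tangent_bundle M).

Definition tangent_smooth_on (B : set TM) (F : TM -> R) : Prop :=
  forall c, atlas c ->
    smooth_on (tangent_preim c B) (F \o tangent_param c).

Definition slit (A : set TM) : set TM := [set v | A v /\ vec v != 0].

Definition tangent_scale (a : R) (v : TM) : TM :=
  Tangent (base v) (a *: vec v).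

(* A function A -> [0, oo) is represented by a total function on TM of which
   only the values on [A] matter. *)
Record conic_pseudo_finsler (A : set TM) (F : TM -> R) : Prop := {
  cpf_open : open A;
  cpf_proj : @base R n M @` A = setT;
  cpf_conic : forall v a, A v -> 0 < a -> A (tangent_scale a v);
  cpf_ge0 : forall v, A v -> 0 <= F v;
  cpf_continuous : {in A, continuous F};
  cpf_smooth : tangent_smooth_on (slit A) F;
  cpf_eq0 : forall v, A v -> (F v = 0 <-> vec v = 0);
  cpf_homog : forall v a, A v -> 0 < a -> F (tangent_scale a v) = a * F v
}.

Definition fundamental_tensor (F : TM -> R) (v : TM) (u w : 'rV[R]_n) : R :=
  2^-1 * derive1 (fun t => derive1 (fun s =>
    F (Tangent (base v) (vec v + t *: u + s *: w)) ^+ 2) 0) 0.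

Record conic_finsler (A : set TM) (F : TM -> R) : Prop := {
  cf_pseudo : conic_pseudo_finsler A F;
  cf_posdef : forall v, slit A v ->
    forall w : 'rV[R]_n, w != 0 -> 0 < fundamental_tensor F v w w
}.

Definition angular_metric (F : TM -> R) (v : TM) (w : 'rV[R]_n) : R :=
  fundamental_tensor F v w w
  - ((F v) ^+ 2)^-1 * fundamental_tensor F v (vec v) w ^+ 2.

(* The domain A: for nonzero v, v is in A iff v is in A0 and F2(v)/F1(v) is in
   I; the zero vector of T_pM is in A iff all nonzero vectors of T_pM are. *)
Definition phi_domain (A0 : set TM) (F1 F2 : TM -> R) (I : set R) : set TM :=
  let B := [set v | slit A0 v /\ I (F2 v / F1 v)] in
  B `|` [set v | vec v = 0 /\
                 forall w : 'rV[R]_n, w != 0 -> B (Tangent (base v) w)].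

(* At a zero vector F2 / F1 has the form 0/0; the value there is F(0_p) = 0. *)
Definition phi_metric (F1 F2 : TM -> R) (phi : R -> R) (v : TM) : R :=
  if vec v == 0 then 0 else F1 v * phi (F2 v / F1 v).

End ConicFinsler.

(* Main.v *)
(* Along a ray, put f_i(r) = F_i(v + r w).  Homogeneity gives
   g^i_v(w,w) = f_i'^2 + f_i f_i'', g^i_v(v,w) = f_i f_i' and
   h^i_v(w,w) = f_i f_i'' at r = 0, so the formula for g is the second
   derivative at 0 of f_1^2 psi(f_2 / f_1).  All four summands are nonnegative
   under the sign conditions; h^1_v(w,w) equals g^1_v on w - l v, where
   l = f_1'(0) / f_1(0), so the first summand vanishes only if w = l v, in which
   case the last one is positive.  For the zero section, homogeneity and
   compactness of the unit sphere give F <= C |y| near a point whose whole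
   punctured fibre lies in the domain, hence openness of A and continuity of F
   there. *)
Require Import Defs.
From mathcomp Require Import all_boot all_order all_algebra.
From mathcomp Require Import all_classical all_reals all_analysis.
From mathcomp Require Import ring lra.
Import Order.TTheory GRing.Theory Num.Theory.
Import numFieldNormedType.Exports.
Local Open Scope classical_set_scope.
Local Open Scope ring_scope.

(** * Smooth functions on open subsets of a normed space *)

Lemma near_eq_differentiable (R : numFieldType) (V W : normedModType R)
    (f g : V -> W) (x : V) :
  {near x, f =1 g} -> differentiable f x ->
  'd g x = 'd f x :> (V -> W) /\ differentiable g x.
Proof.
move=> fg df.
have dfc := diff_continuous df.
(* The first-order expansion of [f] at [x] is also one for [g]; uniqueness of the differential then
   identifies the two. *)
have E : g \o shift x = cst (g x) + 'd f x +o_ 0 id.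
  apply/eqaddoP => e e0.
  have /eqaddoP /(_ e e0) := diff_locally df.
  rewrite (nbhs_singleton fg) /=.
  have fg0 : \forall h \near 0, f (h + x) = g (h + x).
    by move: fg; rewrite (near_shift 0)/=; apply: filterS => h; rewrite subr0.
  by apply: filterS2 fg0 => h /= fgh; rewrite /shift/= !fctE /= fgh.
have dE : 'd g x = 'd f x :> (V -> W) by exact: diff_unique.
split; first exact: dE.
move: dE dfc E; move: ('d f x : V -> W) => d <- dc E.
exact/diff_locallyP.
Qed.

Lemma diff1_scale (R : realType) (phi : R -> R) (a y : R) :
  differentiable phi a -> 'd phi a y = derive1 phi a * y.
Proof. by move=> dphi; rewrite (diff1E dphi) mulrC. Qed.

Section smooth_on_theory.
Context (R : realType) (V : normedModType R).
Implicit Types (U : set V) (W : normedModType R).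

(** Smoothness up to a finite order, so that the product, chain and quotient rules can go by
    induction on the order. The recursion differentiates [f] first, which corresponds to the last
    entry of the list in [smooth_on]; hence the [rcons] in [smooth_orderP]. *)
Fixpoint smooth_order (k : nat) W U (f : V -> W) : Prop :=
  (forall x, U x -> differentiable f x) /\
  (if k is k'.+1 then forall v, smooth_order k' W U ('D_v f) else True).

Lemma smooth_orderP W U (f : V -> W) :
  smooth_on U f <-> forall k, smooth_order k W U f.
Proof.
split=> [sf k|sf vs].
  elim: k f sf => [|k IH] f sf; split=> //; try exact: (sf [::]).
  by move=> v; apply: IH => vs x Ux; have := sf (rcons vs v) x Ux; rewrite foldr_rcons.
have := sf (size vs).
elim/last_ind: vs f {sf} => [|vs v IH] f; first by case.
by rewrite size_rcons foldr_rcons => -[_ /(_ v)]; exact: IH.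
Qed.

Lemma smooth_orderW k W U (f : V -> W) :
  smooth_order k.+1 W U f -> smooth_order k W U f.
Proof.
elim: k f => [|k IH] f [df sf]; split=> // v; exact: IH.
Qed.

(** Since [U] is open, equality on [U] is equality of germs at its points, and directional
    derivatives depend only on germs. *)
Lemma eq_smooth_order k W U (f g : V -> W) : open U ->
  (forall x, U x -> f x = g x) -> smooth_order k W U f -> smooth_order k W U g.
Proof.
move=> oU; have Unear (f' g' : V -> W) x :
    (forall x, U x -> f' x = g' x) -> U x -> {near x, f' =1 g'}.
  by move=> fg Ux; apply: filterS (open_nbhs_nbhs (conj oU Ux)) => y; exact: fg.
elim: k f g => [|k IH] f g fg [df sf]; split=> //.
- by move=> x Ux; have [] := near_eq_differentiable _ _ _ _ _ _ (Unear _ _ _ fg Ux) (df x Ux).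
- by move=> x Ux; have [] := near_eq_differentiable _ _ _ _ _ _ (Unear _ _ _ fg Ux) (df x Ux).
- by move=> v; apply: IH (sf v) => x Ux; apply: near_eq_derive; exact: (Unear _ _ _ fg Ux).
Qed.

Lemma smooth_orderD k U (f g : V -> R) : open U ->
  smooth_order k R U f -> smooth_order k R U g ->
  smooth_order k R U (fun x => f x + g x).
Proof.
move=> oU; elim: k f g => [|k IH] f g [df sf] [dg sg]; split=> //;
  try by move=> x Ux; apply: differentiableD; [exact: df|exact: dg].
move=> v; apply: (eq_smooth_order _ _ _ (fun x => 'D_v f x + 'D_v g x)) => //.
  by move=> x Ux; rewrite -deriveD//; apply: diff_derivable; [exact: df|exact: dg].
exact: (IH _ _ (sf v) (sg v)).
Qed.

Lemma smooth_orderM k U (f g : V -> R) : open U ->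
  smooth_order k R U f -> smooth_order k R U g ->
  smooth_order k R U (fun x => f x * g x).
Proof.
move=> oU; elim: k f g => [|k IH] f g /[dup] sf0 [df sf] /[dup] sg0 [dg sg];
  split=> //; try by move=> x Ux; apply: differentiableM; [exact: df|exact: dg].
move=> v.
apply: (eq_smooth_order _ _ _ (fun x => f x * 'D_v g x + g x * 'D_v f x)) => //.
  by move=> x Ux; rewrite -[RHS]/('D_v (f * g) x) deriveM//; apply: diff_derivable;
    [exact: df|exact: dg].
by apply: smooth_orderD => //; [exact: IH (smooth_orderW _ _ _ _ sf0) (sg v)
  |exact: IH (smooth_orderW _ _ _ _ sg0) (sf v)].
Qed.

(** By the chain rule D_v(phi o h) = (phi' o h) D_v h. The induction generalises [phi], so that its
    hypothesis applies to phi', whose derivatives are again those of [phi]. *)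
Lemma smooth_order_comp k U (I : set R) (h : V -> R) (phi : R -> R) : open U ->
  (forall j s, I s -> derivable (derive1n j phi) s 1) ->
  (forall x, U x -> I (h x)) ->
  smooth_order k R U h -> smooth_order k R U (phi \o h).
Proof.
move=> oU + hI; elim: k h phi hI => [|k IH] h phi hI sphi /[dup] sh0 [dh sh];
  (have dphi s : I s -> differentiable phi s by move=> Is;
     apply/derivable1_diffP; exact: (sphi 0%N));
  split=> //;
  try by move=> x Ux; apply: differentiable_comp; [exact: dh|exact/dphi/hI].
move=> v.
apply: (eq_smooth_order _ _ _ (fun x => (derive1 phi \o h) x * 'D_v h x)) => //.
  move=> x Ux; have dphix := dphi _ (hI x Ux); have dhx := dh x Ux.
  rewrite !deriveE//; last exact: differentiable_comp.
  by rewrite (diff_comp dhx dphix) [RHS]diff1_scale.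
apply: smooth_orderM (sh v) => //.
apply: (IH h (derive1 phi) hI _ (smooth_orderW _ _ _ _ sh0)) => j s Is.
by rewrite -derive1Sn; exact: sphi.
Qed.

(** D_v(1/f) = -(1/f)^2 D_v f involves 1/f itself only to the previous order, so the order can be
    raised one step at a time. *)
Lemma smooth_orderV k U (f : V -> R) : open U -> (forall x, U x -> f x != 0) ->
  smooth_order k R U f -> smooth_order k R U (fun x => (f x)^-1).
Proof.
move=> oU f0; elim: k f f0 => [|k IH] f f0 /[dup] sf0 [df sf]; split=> //;
  try by move=> x Ux; apply: differentiableV; [exact: df|exact: f0].
move=> v; pose m := (fun x => (f x)^-1).
apply: (eq_smooth_order _ _ _ (fun x => cst (-1) x * (m x * m x) * 'D_v f x)) => //.
  move=> x Ux; rewrite deriveV ?f0//; last by apply: diff_derivable; exact: df.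
  by rewrite /m /cst -invfM expr2 mulN1r.
have sm := IH f f0 (smooth_orderW _ _ _ _ sf0).
apply: smooth_orderM (sf v) => //; apply: smooth_orderM (smooth_orderM _ _ _ _ oU sm sm) => //.
(* What remains is smoothness of the constant factor; generalising its value lets the induction pass
   to its derivative, the constant 0. *)
elim: k (-1) {IH sf0 sf sm} => [|k IH] a; split=> // w.
by apply: (eq_smooth_order _ _ _ (cst 0)) => // x _; rewrite derive_cst.
Qed.

Lemma smooth_onM U (f g : V -> R) : open U ->
  smooth_on U f -> smooth_on U g -> smooth_on U (fun x => f x * g x).
Proof.
move=> oU /smooth_orderP sf /smooth_orderP sg; apply/smooth_orderP => k.
exact: smooth_orderM.
Qed.

Lemma smooth_onV U (f : V -> R) : open U -> (forall x, U x -> f x != 0) ->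
  smooth_on U f -> smooth_on U (fun x => (f x)^-1).
Proof.
move=> oU f0 /smooth_orderP sf; apply/smooth_orderP => k.
exact: smooth_orderV.
Qed.

Lemma smooth_on_comp U (I : set R) (h : V -> R) (phi : R -> R) : open U ->
  (forall j s, I s -> derivable (derive1n j phi) s 1) ->
  (forall x, U x -> I (h x)) -> smooth_on U h -> smooth_on U (phi \o h).
Proof.
move=> oU sphi hI /smooth_orderP sh; apply/smooth_orderP => k.
exact: (smooth_order_comp _ _ I).
Qed.

Lemma eq_smooth_on W U (f g : V -> W) : open U ->
  (forall x, U x -> f x = g x) -> smooth_on U f -> smooth_on U g.
Proof.
move=> oU fg /smooth_orderP sf; apply/smooth_orderP => k.
exact: (eq_smooth_order _ _ _ f).
Qed.

Lemma sub_smooth_on W U U' (f : V -> W) : U `<=` U' ->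
  smooth_on U' f -> smooth_on U f.
Proof. by move=> UU' sf vs x /UU'; exact: sf. Qed.

End smooth_on_theory.

(** * Transition maps and bundle charts of the tangent bundle *)

Section charts.
Context (R : realType) (n : nat) (M : smooth_manifold R n).
Local Notation TM := (tangent_bundle M).
Implicit Types (c d : chart R n M) (p : M) (x y : 'rV[R]_n).

Lemma near_chart_overlap c d x : chart_cod c x -> chart_dom d (chart_inv c x) ->
  \forall x' \near x, chart_cod c x' /\ chart_dom d (chart_inv c x').
Proof.
move=> cx dx; have cx' : x \in chart_cod c by rewrite inE.
have nc := open_nbhs_nbhs (conj (@chart_open_cod _ _ _ c) cx).
have nd := open_nbhs_nbhs (conj (@chart_open_dom _ _ _ d) dx).
by apply: filterS2 nc (chart_inv_continuous cx' nd).
Qed.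

Lemma transition_differentiable c d x : atlas c -> atlas d ->
  chart_cod c x -> chart_dom d (chart_inv c x) ->
  differentiable (chart_map d \o chart_inv c) x.
Proof. by move=> ac ad cx dx; exact: (atlas_smooth ac ad [::]). Qed.

(** [S \o T] is the identity near [x], so by the chain rule the differential of [S] undoes that of
    [T]. *)
Lemma transition_diffK c d x y : atlas c -> atlas d ->
  chart_cod c x -> chart_dom d (chart_inv c x) ->
  'd (chart_map c \o chart_inv d) (chart_map d (chart_inv c x))
    ('d (chart_map d \o chart_inv c) x y) = y.
Proof.
move=> ac ad cx dx; set T := chart_map d \o chart_inv c.
set S := chart_map c \o chart_inv d.
have dT : differentiable T x by exact: transition_differentiable.
have dS : differentiable S (T x).
  apply: transition_differentiable => //; first exact: chart_mapP.
  by rewrite /T/= chart_mapK//; exact: chart_invP.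
have STid : {near x, (id : 'rV[R]_n -> _) =1 S \o T}.
  have := near_chart_overlap _ _ _ cx dx; apply: filterS => x' [cx' dx'].
  by rewrite /S /T /= chart_mapK// chart_invK.
have [E _] := near_eq_differentiable _ _ _ _ _ _ STid
  (ex_diff (is_diff_def := is_diff_id x)).
have E1 := diff_comp dT dS.
have E2 : ('d id x : 'rV[R]_n -> _) = id by exact: (diff_val (is_diff_def := is_diff_id x)).
change (('d S (T x) \o 'd T x) y = y).
by rewrite -E1 E E2.
Qed.

Lemma atlas_chart_at p : atlas (chart_at p).
Proof. exact: (s2valP (cid2 (atlas_cover p))). Qed.

Lemma chart_dom_chart_at p : chart_dom (chart_at p) p.
Proof. exact: (s2valP' (cid2 (atlas_cover p))). Qed.

Lemma tangent_paramZ c x y (a : R) :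
  tangent_param c (x, a *: y) = tangent_scale a (tangent_param c (x, y)) :> TM.
Proof. by rewrite /tangent_param /tangent_scale /= linearZ. Qed.

(** The differential of a transition map has a left inverse by [transition_diffK], so it kills only
    0. Removing the zero section therefore looks the same in every bundle chart. *)
Lemma vec_tangent_param_eq0 c z : atlas c -> chart_cod c z.1 ->
  (vec (tangent_param c z : TM) == 0) = (z.2 == 0).
Proof.
move=> ac cz; apply/eqP/eqP => [|z0]; last by rewrite /= z0; exact: linear0.
set d := chart_at (chart_inv c z.1) => E.
have E' : 'd (chart_map d \o chart_inv c) (z.1) (z.2) = 0 by exact: E.
have K := transition_diffK c d z.1 z.2 ac (atlas_chart_at _) cz (chart_dom_chart_at _).
pose D := 'd (chart_map c \o chart_inv d) (chart_map d (chart_inv c z.1)).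
by rewrite -K; exact: etrans (congr1 D E') (linear0 D).
Qed.

(** The preimage of [w] is its image under the differential of the reverse transition, from
    [chart_at p] to [c]. *)
Lemma tangent_param_surj c x (w : 'rV[R]_n) : atlas c -> chart_cod c x ->
  exists y, tangent_param c (x, y) = Tangent (chart_inv c x) w :> TM.
Proof.
move=> ac cx; set p := chart_inv c x; pose d := chart_at p.
have ad : atlas d by exact: atlas_chart_at.
have dp : chart_dom d p by exact: chart_dom_chart_at.
have E : chart_inv d (chart_map d p) = p by rewrite chart_mapK.
exists ('d (chart_map c \o chart_inv d) (chart_map d p) w).
rewrite /tangent_param /= -/p; congr Tangent.
have := transition_diffK d c (chart_map d p) w ad ac (chart_mapP dp).
by rewrite E /p chart_invK//; apply; exact: chart_invP.
Qed.

(** The transition from [chart_at p] to itself is the identity near the point. Hence straight lines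
    in the fibre over [p] are straight lines in this bundle chart. *)
Lemma tangent_param_chart_at p y :
  tangent_param (chart_at p) (chart_map (chart_at p) p, y) = Tangent p y.
Proof.
have dp := chart_dom_chart_at p.
rewrite /tangent_param /= chart_mapK//; congr Tangent.
have IDid : {near chart_map (chart_at p) p, (id : 'rV[R]_n -> _) =1
    chart_map (chart_at p) \o chart_inv (chart_at p)}.
  apply: filterS (open_nbhs_nbhs (conj (@chart_open_cod _ _ _ (chart_at p)) (chart_mapP dp))).
  by move=> x cx /=; rewrite chart_invK.
have [E _] := near_eq_differentiable _ _ _ _ _ _ IDid
  (ex_diff (is_diff_def := is_diff_id _)).
have E2 : ('d id (chart_map (chart_at p) p) : 'rV[R]_n -> _) = id.
  exact: (diff_val (is_diff_def := is_diff_id _)).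
by rewrite E E2.
Qed.

Lemma tangent_openP (B : set TM) :
  open B <-> forall c, atlas c -> open (tangent_preim c B).
Proof. by []. Qed.

(** Open sets of the bundle are those with open preimages in all bundle charts. Since [A] is open,
    continuity in charts makes the part of [A] that [F] sends into an open set open in the
    bundle. *)
Lemma tangent_continuous (T : topologicalType) (A : set TM) (F : TM -> T) :
  open A ->
  (forall c z, atlas c -> tangent_preim c A z -> {for z, continuous (F \o tangent_param c)}) ->
  {in A, continuous F}.
Proof.
move=> oA cF v /[!inE] Av V; rewrite nbhsE => -[V' [oV' V'v] V'V].
apply: (filterS (P := A `&` F @^-1` V')); first by move=> u [_ /V'V].
apply: open_nbhs_nbhs; split => //; apply/tangent_openP => c ac.
rewrite openE => z [cz [Az Vz]].
have oAc := (tangent_openP A).1 oA c ac.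
have nA := open_nbhs_nbhs (conj oAc (conj cz Az : tangent_preim c A z)).
have nV := cF c z ac (conj cz Az) _ (open_nbhs_nbhs (conj oV' Vz)).
by apply: filterS2 nA nV => z' [cz' Az'] Vz'; split.
Qed.

End charts.

(** * A uniform linear bound near the zero section *)

Lemma compact_unit_sphere (R : realType) n :
  compact [set y : 'rV[R]_n | `|y| = 1].
Proof.
apply: bounded_closed_compact.
  exists 1; split; first exact: real1.
  by move=> M M1 y /= ->; exact: ltW.
rewrite (_ : [set y | _] = Num.norm @^-1` [set (1 : R)]); last first.
  by apply/seteqP; split.
by apply: closed_comp => [y _|]; [exact: norm_continuous|exact: closed_eq].
Qed.

(** Each unit vector has a neighbourhood on which [W] and a bound on [G] persist; compactness of the
    sphere makes the neighbourhood of [x] and the bound common to all directions. Homogeneity then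
    carries both to every nonzero [y]. *)
Lemma near_zero_section (R : realType) (X : topologicalType) n
    (W : set (X * 'rV[R]_n)) (G : X * 'rV[R]_n -> R) (x : X) :
  open W ->
  (forall z a, W z -> 0 < a -> W (z.1, a *: z.2)) ->
  (forall z, W z -> {for z, continuous G}) ->
  (forall z a, W z -> 0 < a -> G (z.1, a *: z.2) = a * G z) ->
  (forall y, y != 0 -> W (x, y)) ->
  exists2 C, 0 < C & \forall x' \near x, forall y, y != 0 ->
    W (x', y) /\ G (x', y) <= C * `|y|.
Proof.
move=> oW conicW cG homG Wx; set S := [set y : 'rV[R]_n | `|y| = 1].
pose P (i : X * R) y := W (i.1, y) /\ G (i.1, y) <= i.2.
have /compact_near_coveringP cS : compact S by exact: compact_unit_sphere.
(* The parameter is a pair of a point near [x] and a bound near +oo, so that one covering argument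
   yields both uniformly. *)
have : \forall i \near filter_prod (nbhs x) (+oo : set_system R), S `<=` P i.
  apply: cS => y Sy; have y0 : y != 0 by rewrite -normr_eq0 Sy oner_eq0.
  (* The slack 1 makes the inequality strict at (x, y), hence stable nearby. *)
  have : \forall z \near (x, y), W z /\ G z < G (x, y) + 1.
    have nG : nbhs (G (x, y)) [set r | r < G (x, y) + 1].
      by apply: open_nbhs_nbhs; split; [exact: open_lt|rewrite /= ltrDl].
    have nW := open_nbhs_nbhs (conj oW (Wx y y0)).
    exact: filterI nW (cG _ (Wx y y0) _ nG).
  move=> [[A B] /= [xA yB] AB].
  exists (B, [set i | A i.1 /\ G (x, y) + 1 <= i.2]) => /=.
    split => //; exists (A, [set r | G (x, y) + 1 <= r]) => /=.
      by split => //; apply: nbhs_pinfty_ge; exact: num_real.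
    by move=> [i r] [].
  move=> [y' [x' r]] /= [By' [Ax' rr]]; have [/= Wz Gz] := AB (x', y') (conj Ax' By').
  by split => //=; exact: le_trans (ltW Gz) rr.
move=> [[A V] /= [xA [r [_ rV]]] AV].
(* The neighbourhood [V] of +oo contains every number above [r]; the maximum with 0 makes the
   constant positive as well. *)
pose C := Num.max 0 r + 1; have C0 : 0 < C.
  by rewrite ltr_pwDr// le_max lexx.
have VC : V C by apply: rV; rewrite /C ltr_pwDr// le_max lexx orbT.
exists C => //; apply: filterS xA => x' Ax' y y0.
have ny0 : 0 < `|y| by rewrite normr_gt0.
have Su : S (`|y|^-1 *: y).
  by rewrite /S /= normrZ ger0_norm ?invr_ge0// mulVf// gt_eqF.
have [/= Wu Gu] := AV (x', C) (conj Ax' VC) _ Su.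
have yE : y = `|y| *: (`|y|^-1 *: y) by rewrite scalerA divff ?scale1r// gt_eqF.
split; first by rewrite yE; exact: (conicW (x', _)).
rewrite {1}yE (homG (x', `|y|^-1 *: y))// mulrC.
by rewrite ler_pM2r.
Qed.

(** * Adding zero vectors to an open conic set of nonzero vectors *)

Section conic_extension.
Context (R : realType) (n : nat) (M : smooth_manifold R n).
Local Notation TM := (tangent_bundle M).
Implicit Types (A B : set TM) (F : TM -> R) (c : chart R n M).

(** The zero-vector convention of [phi_domain] for an arbitrary [B], so that the topology at the
    zero section is treated apart from the metric. *)
Definition zero_extension B : set TM :=
  B `|` [set v | vec v = 0 /\ forall w : 'rV[R]_n, w != 0 -> B (Tangent (base v) w)].

Lemma tangent_preim_slit c A : atlas c ->
  tangent_preim c (slit A) = tangent_preim c A `&` [set z | z.2 != 0].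
Proof.
move=> ac; apply/seteqP; split=> z /=.
  by move=> [cz [Az]]; rewrite vec_tangent_param_eq0.
by move=> [[cz Az] z0]; split=> //; split=> //; rewrite vec_tangent_param_eq0.
Qed.

Lemma open_slit A : open A -> open (slit A).
Proof.
move=> /tangent_openP oA; apply/tangent_openP => c ac.
rewrite tangent_preim_slit//; apply: openI; first exact: oA.
apply: (@open_comp _ _ snd [set y : 'rV[R]_n | y != 0]).
  by move=> z _; exact: cvg_snd.
rewrite (_ : [set y | _] = ~` [set (0 : 'rV[R]_n)]); last first.
  by apply/seteqP; split=> y /=; [move/eqP|move/eqP].
apply: closed_openC; apply: accessible_closed_set1.
exact: hausdorff_accessible (@norm_hausdorff _ _).
Qed.

Lemma slit_zero_extension B : (forall v, B v -> vec v != 0) ->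
  slit (zero_extension B) = B.
Proof.
move=> B0; apply/seteqP; split=> v; last by move=> Bv; split; [left|exact: B0].
by move=> [[//|[-> _]]]; rewrite eqxx.
Qed.

Section zero_section.
Variables (B : set TM) (F : TM -> R).
Hypotheses (oB : open B) (B_neq0 : forall v, B v -> vec v != 0).
Hypothesis B_conic : forall v a, B v -> 0 < a -> B (tangent_scale a v).
Hypothesis F_homog : forall v a, B v -> 0 < a -> F (tangent_scale a v) = a * F v.
Hypothesis F_cont : forall c z, atlas c -> tangent_preim c B z ->
  {for z, continuous (F \o tangent_param c)}.

(** [B] has no zero vectors, so a zero vector of the extension has its whole punctured fibre in [B].
    Then [near_zero_section], applied in the bundle chart, gives the same for nearby fibres, which
    thus lie entirely in the extension. *)
Lemma zero_extension_bound c x : atlas c -> chart_cod c x ->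
  zero_extension B (tangent_param c (x, 0)) ->
  exists2 C, 0 < C & \forall x' \near x,
    (forall y, tangent_preim c (zero_extension B) (x', y)) /\
    (forall y, y != 0 -> tangent_preim c B (x', y) /\
       F (tangent_param c (x', y)) <= C * `|y|).
Proof.
move=> ac cx Bx0.
have vec0 : vec (tangent_param c (x, 0) : TM) = 0.
  by apply/eqP; rewrite vec_tangent_param_eq0.
have {Bx0}[_ Bx] : vec (tangent_param c (x, 0) : TM) = 0 /\
    forall w : 'rV[R]_n, w != 0 -> B (Tangent (chart_inv c x) w).
  by case: Bx0 => // /B_neq0; rewrite vec0 eqxx.
have Wx y : y != 0 -> tangent_preim c B (x, y).
  by move=> y0; split=> //; apply: Bx; rewrite (vec_tangent_param_eq0 _ _ _ _ (x, y)).
have [|||C C0 nC] := near_zero_section _ _ _ (tangent_preim c B)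
    (F \o tangent_param c) x ((tangent_openP _ _ _ B).1 oB c ac) _ _ _ Wx.
- move=> [x' y] a [cx' Bz] a0; split=> //=.
  by rewrite tangent_paramZ; exact: B_conic.
- by move=> z Wz; exact: F_cont.
- move=> [x' y] a [cx' Bz] a0 /=.
  by rewrite tangent_paramZ; exact: F_homog.
exists C => //.
have nc := open_nbhs_nbhs (conj (@chart_open_cod _ _ _ c) cx).
apply: filterS2 nc nC => x' cx' Wx'; split; last exact: Wx'.
move=> y; split=> //; have [->|y0] := eqVneq y 0; last first.
  by left; have [[_ Bz] _] := Wx' y y0.
right; split; first by apply/eqP; rewrite vec_tangent_param_eq0.
(* The convention speaks of [chart_at] coordinates, whereas the bound is in the chart [c];
   surjectivity on fibres translates one into the other. *)
move=> w w0; have [y' E] := tangent_param_surj _ _ _ _ x' w ac cx'.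
have y'0 : y' != 0.
  have := vec_tangent_param_eq0 _ _ _ _ (x', y') ac cx'.
  by rewrite E /= => <-.
by have [[_]] := Wx' y' y'0; rewrite E.
Qed.

Lemma open_zero_extension : open (zero_extension B).
Proof.
apply/tangent_openP => c ac; rewrite openE => -[x y] /= [cx Bz].
case: Bz => [Bz|[/eqP vz Bz]].
  have := open_nbhs_nbhs (conj ((tangent_openP _ _ _ B).1 oB c ac)
    (conj cx Bz : tangent_preim c B (x, y))).
  by apply: filterS => z [cz Bz']; split=> //; left.
move: vz; rewrite vec_tangent_param_eq0//= => /eqP y0.
rewrite y0 in Bz *.
have [|C C0 nC] := zero_extension_bound c x ac cx.
  by right; split=> //; apply/eqP; rewrite vec_tangent_param_eq0.
(* At a zero vector the neighbourhood consists of entire fibres over a neighbourhood of [x]. *)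
exists ([set x' | forall y, tangent_preim c (zero_extension B) (x', y)], setT).
  by split; [apply: filterS nC => x' []|exact: filterT].
by move=> [x' y'] /= [+ _]; exact.
Qed.

(** At nonzero vectors continuity is [F_cont]. At a zero vector F <= C |y| on nearby fibres, so |y|
    < e / C forces F < e. *)
Lemma continuous_zero_extension :
  (forall v, B v -> 0 <= F v) -> (forall v, vec v = 0 -> F v = 0) ->
  {in zero_extension B, continuous F}.
Proof.
move=> F_ge0 F_eq0; apply: tangent_continuous open_zero_extension _.
move=> c [x y] ac [cx /= Bz].
have [y0|y0] := eqVneq y 0; last first.
  apply: F_cont => //; split=> //; case: Bz => // -[/eqP].
  by rewrite vec_tangent_param_eq0//= (negbTE y0).
rewrite y0 in Bz *.
have F0 z : chart_cod c z.1 -> z.2 = 0 -> F (tangent_param c z) = 0.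
  by move=> cz z0; apply: F_eq0; apply/eqP; rewrite vec_tangent_param_eq0// z0.
have [C C0 nC] := zero_extension_bound c x ac cx Bz.
apply/cvgrPdist_lt => e e0; rewrite /= F0//.
have neC : nbhs (0 : 'rV[R]_n) [set y | `|y| < e / C].
  have eC : 0 < e / C by rewrite divr_gt0.
  apply: filterS (nbhsx_ballx (0 : 'rV[R]_n) _ eC) => u.
  by rewrite -ball_normE /= sub0r normrN.
exists ([set x' | (forall y, tangent_preim c (zero_extension B) (x', y)) /\
    (forall y, y != 0 -> tangent_preim c B (x', y) /\
       F (tangent_param c (x', y)) <= C * `|y|)], [set y | `|y| < e / C]) => //=.
move=> [x' y'] /= [[Bx' Cx'] y'e]; rewrite sub0r normrN.
have [y'0|y'0] := eqVneq y' 0.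
  by rewrite F0// ?normr0//; have [] := Bx' 0.
have [[_ Bz'] FC] := Cx' y' y'0.
rewrite ger0_norm; last exact: F_ge0.
by rewrite (le_lt_trans FC)// mulrC -ltr_pdivlMr.
Qed.

End zero_section.

Lemma zero_extension_conic B : (forall v a, B v -> 0 < a -> B (tangent_scale a v)) ->
  forall v a, zero_extension B v -> 0 < a -> zero_extension B (tangent_scale a v).
Proof.
move=> Bc v a [Bv|[v0 Bv]] a0; first by left; exact: Bc.
by right; split=> //=; rewrite v0 scaler0.
Qed.

End conic_extension.

(** * The pseudo-Finsler axioms for [phi_metric] *)

Lemma open_preim_in (X Y : topologicalType) (U : set X) (h : X -> Y) (I : set Y) :
  open U -> open I -> (forall x, U x -> {for x, continuous h}) ->
  open [set x | U x /\ I (h x)].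
Proof.
move=> oU oI ch; rewrite openE => x [Ux Ihx].
have nU := open_nbhs_nbhs (conj oU Ux).
exact: filterI nU (ch x Ux _ (open_nbhs_nbhs (conj oI Ihx))).
Qed.

Section phi_metric_pseudo_finsler.
Context (R : realType) (n : nat) (M : smooth_manifold R n).
Local Notation TM := (tangent_bundle M).

Lemma cpf_gt0 (A : set TM) (F : TM -> R) (v : TM) :
  conic_pseudo_finsler A F -> slit A v -> 0 < F v.
Proof.
move=> hF [Av v0]; rewrite lt_neqAle (cpf_ge0 hF Av) andbT eq_sym.
by apply: contra_neq v0 => /(cpf_eq0 hF Av).
Qed.

Lemma open_tangent_preim_slit (A : set TM) (c : chart R n M) :
  open A -> atlas c -> open (tangent_preim c (slit A)).
Proof. by move=> /open_slit/tangent_openP; exact. Qed.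

Context (A0 : set TM) (F1 F2 : TM -> R) (I : set R) (phi : R -> R).
Hypotheses (hF1 : conic_pseudo_finsler A0 F1) (hF2 : conic_pseudo_finsler A0 F2).
Hypotheses (hI : open I)
  (phi_smooth : forall (k : nat) (s : R), I s -> derivable (derive1n k phi) s 1)
  (phi_gt0 : forall s, I s -> 0 < phi s).
Let B := [set v | slit A0 v /\ I (F2 v / F1 v)].
Let F := phi_metric F1 F2 phi.

Lemma slit_phi_domain : slit (phi_domain A0 F1 F2 I) = B.
Proof. by apply: slit_zero_extension => v [[]]. Qed.

Lemma phi_metricE v : B v -> F v = F1 v * phi (F2 v / F1 v).
Proof. by move=> [[_ v0] _]; rewrite /F /phi_metric (negbTE v0). Qed.

Lemma smooth_on_ratio (c : chart R n M) : atlas c ->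
  smooth_on (tangent_preim c (slit A0))
    (fun z => F2 (tangent_param c z) / F1 (tangent_param c z)).
Proof.
move=> ac; have oU := open_tangent_preim_slit _ _ (cpf_open hF1) ac.
apply: smooth_onM => //; first exact: (cpf_smooth hF2).
apply: smooth_onV => //; last exact: (cpf_smooth hF1).
by move=> z [cz Az]; rewrite gt_eqF// (cpf_gt0 _ _ _ hF1).
Qed.

Lemma open_tangent_preim_ratio (c : chart R n M) : atlas c -> open (tangent_preim c B).
Proof.
move=> ac; have oU := open_tangent_preim_slit _ _ (cpf_open hF1) ac.
have := open_preim_in _ _ _
  (fun z => F2 (tangent_param c z) / F1 (tangent_param c z)) I oU hI.
rewrite (_ : tangent_preim c B = [set z | tangent_preim c (slit A0) z /\
  I (F2 (tangent_param c z) / F1 (tangent_param c z))]); last first.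
  by apply/seteqP; split=> z; rewrite /tangent_preim /B/=; tauto.
apply => z Uz; apply: differentiable_continuous.
exact: (smooth_on_ratio c ac [::] z Uz).
Qed.

Lemma phi_metric_smooth_on : tangent_smooth_on B F.
Proof.
move=> c ac; have oU := open_tangent_preim_ratio _ ac.
have BA0 : tangent_preim c B `<=` tangent_preim c (slit A0) by move=> z [cz []].
pose r z := F2 (tangent_param c z) / F1 (tangent_param c z).
apply: (eq_smooth_on _ _ _ _ (fun z => F1 (tangent_param c z) * (phi \o r) z)) => //.
  by move=> z [cz Bz]; rewrite /= phi_metricE.
apply: smooth_onM => //; first exact: sub_smooth_on BA0 (cpf_smooth hF1 ac).
apply: (smooth_on_comp _ _ _ I) => //; first by move=> z [_ []].
exact: sub_smooth_on BA0 (smooth_on_ratio _ ac).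
Qed.

(** The ratio F2 / F1 is homogeneous of degree 0, so it stays in [I] along each open half-line. *)
Lemma ratio_conic v a : B v -> 0 < a -> B (tangent_scale a v).
Proof.
move=> [[Av v0] Iv] a0; have a0' : a != 0 by rewrite gt_eqF.
split; first by split; [exact: (cpf_conic hF1)|rewrite /= scaler_eq0 negb_or a0'].
by rewrite (cpf_homog hF1 Av a0) (cpf_homog hF2 Av a0) -mulf_div divff// mul1r.
Qed.

(** On [B] the axioms are inherited from [F1], [F2] and [phi]. The domain unfolds to
    [zero_extension B], so openness and continuity at the zero vectors come from the preceding
    part. *)
Lemma phi_metric_conic_pseudo_finsler :
  @base R n M @` phi_domain A0 F1 F2 I = setT ->
  conic_pseudo_finsler (phi_domain A0 F1 F2 I) F.
Proof.
have B0 v : B v -> vec v != 0 by case=> [[]].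
have oB : open B by apply/tangent_openP => c ac; exact: open_tangent_preim_ratio.
have FB v a : B v -> 0 < a -> F (tangent_scale a v) = a * F v.
  move=> Bv a0; have [[Av v0] Iv] := Bv; rewrite !phi_metricE//; last exact: ratio_conic.
  rewrite (cpf_homog hF1 Av a0) (cpf_homog hF2 Av a0) -mulf_div divff ?gt_eqF//.
  by rewrite mul1r mulrA.
have F0 v : vec v = 0 -> F v = 0 by move=> v0; rewrite /F /phi_metric v0 eqxx.
have FB0 v : B v -> 0 < F v.
  move=> Bv; have [Av Iv] := Bv; rewrite phi_metricE//.
  by rewrite mulr_gt0 ?phi_gt0// (cpf_gt0 _ _ _ hF1).
have cF c z : atlas c -> tangent_preim c B z -> {for z, continuous (F \o tangent_param c)}.
  move=> ac Bz; apply: differentiable_continuous.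
  exact: (phi_metric_smooth_on c ac [::] z Bz).
move=> hA; split => //.
- exact: (open_zero_extension _ _ _ B F oB B0 ratio_conic FB cF).
- by move=> v a; apply: zero_extension_conic; exact: ratio_conic.
- by move=> v [/FB0/ltW//|[/F0 -> _]].
- apply: (continuous_zero_extension _ _ _ B F oB B0 ratio_conic FB cF) => //.
  by move=> v /FB0/ltW.
- by rewrite slit_phi_domain; exact: phi_metric_smooth_on.
- move=> v [Bv|[v0 _]]; last by split=> // _; exact: F0.
  by split=> [/eqP|]; [rewrite gt_eqF// FB0|move/eqP; rewrite (negbTE (B0 _ Bv))].
- move=> v a [Bv|[v0 _]] a0; first exact: FB.
  by rewrite !F0 ?mulr0//= v0 scaler0.
Qed.

End phi_metric_pseudo_finsler.

(** * One-variable calculus for restrictions to lines *)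

Section one_variable.
Context (R : realType).
Implicit Types f g : R -> R.

(** Turns derivatives along a line into directional derivatives, whose iterates are what [smooth_on]
    controls. *)
Lemma derive1_line (V : normedModType R) (h : V -> R) (a v : V) :
  derive1 (fun r : R => h (a + r *: v)) = (fun r => 'D_v h (a + r *: v)).
Proof.
apply/funext => r; rewrite /derive1 /derive.
pose q s : R := s^-1 *: (h (a + (s + r) *: v) - h (a + r *: v)).
rewrite -[LHS]/(lim (q @ 0^')).
rewrite (_ : q = fun s => s^-1 *: ((h \o shift (a + r *: v)) (s *: v) - h (a + r *: v)))//.
by apply/funext => s; rewrite /q /= scalerDl addrCA.
Qed.

Lemma derivable_line (V : normedModType R) (h : V -> R) (a v : V) (r : R) :
  derivable h (a + r *: v) v -> derivable (fun r : R => h (a + r *: v)) r 1.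
Proof.
move=> dh; rewrite /derivable (_ : (fun _ => _) =
  (fun s => s^-1 *: ((h \o shift (a + r *: v)) (s *: v) - h (a + r *: v))))//.
by apply/funext => s /=; rewrite [s *: 1]mulr1 scalerDl addrCA.
Qed.

Lemma derivable1_is_derive f (x : R) : derivable f x 1 -> is_derive x 1 f (derive1 f x).
Proof. by move=> /derivableP; rewrite derive1E. Qed.

Lemma is_derive1_eq f (x d : R) : is_derive x 1 f d -> derive1 f x = d.
Proof. by move=> fd; rewrite derive1E derive_val. Qed.

Lemma near_eq_derive1 f g (x : R) :
  {near x, f =1 g} -> derive1 f x = derive1 g x.
Proof. by move=> fg; rewrite !derive1E; exact: near_eq_derive. Qed.

Lemma near_eq_derive1_near f g (x : R) :
  {near x, f =1 g} -> {near x, derive1 f =1 derive1 g}.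
Proof. by move=> /near_join; apply: filterS => y; exact: near_eq_derive1. Qed.

Lemma near0_mulr (a : R) (P : set R) : nbhs 0 P ->
  \forall r \near (0 : R), P (r * a).
Proof.
move=> nP; have : (fun r : R => r * a) @ 0 --> 0 * a by apply: cvgMl; exact: cvg_id.
by rewrite mul0r => /(_ P nP).
Qed.

Lemma is_derive_scale1 f (a x d : R) : is_derive (x * a) 1 f d ->
  is_derive x 1 (fun r => f (r * a)) (a * d).
Proof.
move=> fd; have ga : is_derive x 1 (fun r : R => r * a) a.
  have := @is_deriveM R R id (cst a) x 1 1 0 (is_derive_id _ _) (is_derive_cst _ _ _).
  by rewrite scaler0 add0r => /is_derive_eq; apply; rewrite /cst [_ *: _]mulr1.
have := @is_derive1_comp R f (fun r => r * a) x d a fd ga.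
by rewrite mulrC.
Qed.

Lemma derive1_sqr_near f : (\forall r \near (0 : R), derivable f r 1) ->
  \forall r \near (0 : R), derive1 (fun r => f r ^+ 2) r = 2 * f r * derive1 f r.
Proof.
apply: filterS => r /derivable1_is_derive df; apply: is_derive1_eq.
by apply: is_derive_eq (is_deriveX 2 df) _; rewrite /= expr1.
Qed.

Lemma derive2_sqr f : (\forall r \near (0 : R), derivable f r 1) ->
  derivable (derive1 f) 0 1 ->
  derive1 (derive1 (fun r => f r ^+ 2)) 0 =
  2 * (derive1 f 0 ^+ 2 + f 0 * derive1 (derive1 f) 0).
Proof.
move=> df ddf; rewrite (near_eq_derive1 _ _ _ (derive1_sqr_near _ df)).
have df0 := derivable1_is_derive _ _ (nbhs_singleton df).
have ddf0 := derivable1_is_derive _ _ ddf.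
have d2f : is_derive (0 : R) 1 (fun r => 2 * f r) (2 * derive1 f 0) := is_deriveZ 2 df0.
apply: is_derive1_eq; apply: is_derive_eq (is_deriveM d2f ddf0) _.
rewrite /GRing.scale /=; ring.
Qed.

(* The perspective [(1 - l r) f (r / (1 - l r))] is the restriction of a
   1-homogeneous function to the line in direction [w - l v]. *)
Lemma perspective_derive f (l : R) (k : R -> R := fun r => (1 - l * r) * f (r / (1 - l * r))) :
  (\forall r \near (0 : R), derivable f r 1) -> derivable (derive1 f) 0 1 ->
  derive1 k 0 = derive1 f 0 - l * f 0 /\
  derive1 (derive1 k) 0 = derive1 (derive1 f) 0.
Proof.
move=> df ddf.
pose q (r : R) : R := 1 - l * r; pose rho (r : R) : R := r / q r.
have dq (r : R) : is_derive r (1 : R) q (- l).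
  have := @is_deriveB R R R (cst 1) ( *%R l) r 1 0 l (is_derive_cst _ _ _).
  have dl : is_derive r 1 ( *%R l) (l : R).
    by apply: is_derive_eq (is_deriveZ l (is_derive_id r 1)) _; rewrite [_ *: _]mulr1.
  by move=> /(_ dl); rewrite sub0r.
have q0 : q 0 = 1 by rewrite /q mulr0 subr0.
have nq : \forall r \near (0 : R), q r != 0.
  have qc : {for 0, continuous q}.
    by apply: differentiable_continuous; apply/derivable1_diffP; exact: ex_derive.
  have := qc [set x | x != 0]; rewrite q0; apply.
  apply: open_nbhs_nbhs; split; [exact: open_neq|exact: oner_neq0].
have drho (r : R) : q r != 0 -> is_derive r 1 rho ((q r) ^- 2).
  move=> qr; have := @is_deriveM R R id (fun r => (q r)^-1) r 1 1 _ (is_derive_id _ _)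
    (is_deriveV qr (dq r)).
  move=> /is_derive_eq; apply; rewrite /GRing.scale /= /q in qr *; by field.
have rho0 : rho 0 = 0 by rewrite /rho mul0r.
have crho : rho @ (0 : R) --> (0 : R).
  have : {for 0, continuous rho}.
    apply: differentiable_continuous; apply/derivable1_diffP.
    have := drho 0; rewrite q0 => /(_ (oner_neq0 _)) h; exact: ex_derive.
  by move=> h; rewrite -[X in _ --> X]rho0; exact: h.
have near_rho (P : set R) : nbhs 0 P -> \forall r \near (0 : R), P (rho r) := crho P.
(* As rho' = 1 / q^2, the factor [q] leaves f'(rho) / q. On differentiating once more at 0, the
   contributions -l f'(0) and l f'(0) cancel, which leaves f''(0). *)
have dk : \forall r \near (0 : R), derive1 k r = - l * f (rho r) + derive1 f (rho r) / q r.
  have nf : \forall r \near (0 : R), derivable f (rho r) 1.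
    exact: near_rho df.
  apply: filterS2 nq nf => r qr fr; apply: is_derive1_eq.
  have dc := @is_derive1_comp R f rho r _ _ (derivable1_is_derive _ _ fr) (drho r qr).
  have := is_deriveM (dq r) dc; move=> /is_derive_eq; apply.
  by rewrite /GRing.scale /=; field.
split.
  by rewrite (nbhs_singleton dk) rho0 q0; field.
rewrite (near_eq_derive1 _ _ _ dk); apply: is_derive1_eq.
have qn0 : q 0 != 0 by rewrite q0 oner_neq0.
have df0 : is_derive (rho 0) 1 f (derive1 f 0).
  by rewrite rho0; apply: derivable1_is_derive; exact: nbhs_singleton df.
have ddf0 : is_derive (rho 0) 1 (derive1 f) (derive1 (derive1 f) 0).
  by rewrite rho0; apply: derivable1_is_derive.
have c1 := @is_derive1_comp R f rho 0 _ _ df0 (drho 0 qn0).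
have c2 := @is_derive1_comp R (derive1 f) rho 0 _ _ ddf0 (drho 0 qn0).
have := is_deriveD (is_deriveZ (- l) c1) (is_deriveM c2 (is_deriveV qn0 (dq 0))).
move=> /is_derive_eq; apply.
rewrite /GRing.scale /= rho0 q0; by field.
Qed.

End one_variable.

Section square_profile.
Context (R : realType).

(** With q = f2 / f1 one has f1 q' = f2' - q f1', whose value at 0 is [u]. The first derivative then
    becomes f1 (P1(q) f1' + psi'(q) f2') with P1(x) = 2 psi(x) - x psi'(x), and the product rule
    with P1' = psi' - x psi'' gives the second. *)
Lemma derive2_square_profile (f1 f2 psi : R -> R) (I : set R) (s := f2 0 / f1 0) :
  open I -> (forall x, I x -> derivable psi x 1) ->
  (forall x, I x -> derivable (derive1 psi) x 1) ->
  (\forall r \near (0 : R), [/\ f1 r != 0, I (f2 r / f1 r),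
    derivable f1 r 1 & derivable f2 r 1]) ->
  derivable (derive1 f1) 0 1 -> derivable (derive1 f2) 0 1 ->
  let p1 := 2 * psi s - s * derive1 psi s in
  let u := derive1 f2 0 - s * derive1 f1 0 in
  derive1 (derive1 (fun r => f1 r ^+ 2 * psi (f2 r / f1 r))) 0 =
  p1 * (derive1 f1 0 ^+ 2 + f1 0 * derive1 (derive1 f1) 0)
  + derive1 psi s * (derive1 f1 0 * derive1 f2 0 + f1 0 * derive1 (derive1 f2) 0)
  + u * ((derive1 psi s - s * derive1 (derive1 psi) s) * derive1 f1 0
         + derive1 (derive1 psi) s * derive1 f2 0).
Proof.
move=> oI dpsi ddpsi nf ddf1 ddf2 p1 u.
have dq r : f1 r != 0 -> derivable f1 r 1 -> derivable f2 r 1 ->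
    is_derive r 1 (fun r => f2 r / f1 r) ((derive1 f2 r - f2 r / f1 r * derive1 f1 r) / f1 r).
  move=> f1r /derivable1_is_derive df1 /derivable1_is_derive df2.
  have := is_deriveM df2 (is_deriveV f1r df1); move=> /is_derive_eq; apply.
  by rewrite /GRing.scale /=; field.
pose P1 x := 2 * psi x - x * derive1 psi x.
have dG : \forall r \near (0 : R),
    derive1 (fun r => f1 r ^+ 2 * psi (f2 r / f1 r)) r =
    f1 r * (P1 (f2 r / f1 r) * derive1 f1 r + derive1 psi (f2 r / f1 r) * derive1 f2 r).
  apply: filterS nf => r [f1r Ir df1 df2]; apply: is_derive1_eq.
  have dpr := @is_derive1_comp R psi (fun r => f2 r / f1 r) r _ _
    (derivable1_is_derive _ _ _ (dpsi _ Ir)) (dq r f1r df1 df2).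
  have := is_deriveM (is_deriveX 2 (derivable1_is_derive _ _ _ df1)) dpr.
  move=> /is_derive_eq; apply.
  by rewrite /GRing.scale /= /P1 exprfctE; field.
rewrite (near_eq_derive1 _ _ _ _ dG); apply: is_derive1_eq.
have [f10 I0 df1 df2] := nbhs_singleton nf.
have d0 := dq 0 f10 df1 df2.
have dpsis := derivable1_is_derive _ _ _ (dpsi _ I0).
have ddpsis := derivable1_is_derive _ _ _ (ddpsi _ I0).
have dP1 : is_derive s 1 P1 (derive1 psi s - s * derive1 (derive1 psi) s).
  have := is_deriveB (is_deriveZ 2 dpsis) (is_deriveM (is_derive_id s 1) ddpsis).
  by move=> /is_derive_eq; apply; rewrite /GRing.scale /=; ring.
have cP1 := @is_derive1_comp R P1 (fun r => f2 r / f1 r) 0 _ _ dP1 d0.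
have cpsi' := @is_derive1_comp R (derive1 psi) (fun r => f2 r / f1 r) 0 _ _ ddpsis d0.
have := is_deriveM (derivable1_is_derive _ _ _ df1)
  (is_deriveD (is_deriveM cP1 (derivable1_is_derive _ _ _ ddf1))
              (is_deriveM cpsi' (derivable1_is_derive _ _ _ ddf2))).
move=> /is_derive_eq; apply.
rewrite /GRing.scale /= !fctE /= -/s /P1 /u /p1.
move: (derive1 (derive1 f1) 0) (derive1 (derive1 f2) 0) (derive1 f1 0) (derive1 f2 0)
  (derive1 (derive1 psi) s) (derive1 psi s) (psi s) (f1 0) f10 => ? ? ? ? ? ? ? a a0.
by move: (s) => s'; field.
Qed.

End square_profile.

(** * Fundamental tensor and angular metric in terms of rays *)

Section fundamental_tensor_rays.
Context (R : realType) (n : nat) (M : smooth_manifold R n).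
Local Notation TM := (tangent_bundle M).
Implicit Types (v : TM) (w : 'rV[R]_n).

Definition ray (F : TM -> R) v w (r : R) : R := F (Tangent (base v) (vec v + r *: w)).

Lemma ray0 (F : TM -> R) v w : ray F v w 0 = F v.
Proof. by case: v => p y; rewrite /ray /= scale0r addr0. Qed.

(** For equal directions the argument depends only on t + s, so the inner derivative at s = 0 is the
    derivative of the squared ray at t. *)
Lemma fundamental_tensor_diag (F : TM -> R) v w :
  fundamental_tensor F v w w =
  2^-1 * derive1 (derive1 (fun r => ray F v w r ^+ 2)) 0.
Proof.
rewrite /fundamental_tensor; 
rewrite (_ : (fun t => _) = derive1 (fun r => ray F v w r ^+ 2))//.
apply/funext => t.
rewrite /derive1.
pose q h : R := h^-1 *: (ray F v w (h + t) ^+ 2 - ray F v w t ^+ 2).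
rewrite -[RHS]/(lim (q @ 0^')).
congr (lim (_ @ 0^')); apply/funext => h; rewrite /q /ray addr0 scale0r addr0.
by rewrite -[vec v + t *: w + h *: w]addrA -scalerDl [t + h]addrC.
Qed.

Variables (A : set TM) (F : TM -> R).
Hypothesis hF : conic_pseudo_finsler A F.

(** In the bundle chart of [chart_at (base v)] the fibre coordinates are unchanged, so the ray is a
    smooth function restricted to a line. Openness of the slit domain keeps nearby points of the
    line inside it. *)
Lemma near_ray v w : slit A v -> \forall r \near (0 : R),
  [/\ slit A (Tangent (base v) (vec v + r *: w)),
      derivable (ray F v w) r 1 & derivable (derive1 (ray F v w)) r 1].
Proof.
move=> Av; pose c := chart_at (base v); pose x0 := chart_map c (base v).
have ac : atlas c := atlas_chart_at _ _ _ _.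
have cx0 : chart_cod c x0 := chart_mapP (chart_dom_chart_at _ _ _ _).
pose U := tangent_preim c (slit A).
have oU : open U := open_tangent_preim_slit _ _ _ _ _ (cpf_open hF) ac.
pose a : 'rV[R]_n * 'rV[R]_n := (x0, vec v); pose u : 'rV[R]_n * 'rV[R]_n := (0, w).
have lineE r : a + r *: u = (x0, vec v + r *: w).
  by rewrite /a /u; congr pair; rewrite /= scaler0 addr0.
have tpE r : tangent_param c (a + r *: u) = Tangent (base v) (vec v + r *: w).
  by rewrite lineE tangent_param_chart_at.
have rayE : ray F v w = (fun r => (F \o tangent_param c) (a + r *: u)).
  by apply/funext => r; rewrite /= tpE.
have nU : \forall r \near (0 : R), U (a + r *: u).
  have : (fun r : R => a + r *: u) @ 0 --> a + 0 *: u.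
    by apply: cvgD; [exact: cvg_cst|apply: cvgZr_tmp; exact: cvg_id].
  apply; apply: open_nbhs_nbhs; split => //; rewrite lineE scale0r addr0; split => //.
  by rewrite tangent_param_chart_at; case: (v) Av.
apply: filterS nU => r Ur; split.
- by rewrite -tpE; case: Ur.
- rewrite rayE; apply: derivable_line; apply: diff_derivable.
  exact: (cpf_smooth hF ac [::] Ur).
- rewrite rayE derive1_line; apply: (derivable_line _ _ ('D_u (F \o tangent_param c)) a u r).
  by apply: diff_derivable; exact: (cpf_smooth hF ac [:: u] Ur).
Qed.

Lemma fundamental_tensor_diagE v w : slit A v ->
  fundamental_tensor F v w w =
  derive1 (ray F v w) 0 ^+ 2 + F v * derive1 (derive1 (ray F v w)) 0.
Proof.
move=> Av; have nr := near_ray v w Av.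
rewrite fundamental_tensor_diag derive2_sqr ?ray0.
- by rewrite mulrA mulVf ?mul1r.
- by apply: filterS nr => r [].
- by have [] := nbhs_singleton nr.
Qed.

(** With f = [ray F v w], homogeneity gives F((1 + t) v + s w)^2 = (1 + t)^2 f(s / (1 + t))^2. Its
    s-derivative at 0 is (1 + t) 2 F(v) f'(0), which is affine in t. *)
Lemma fundamental_tensor_radial v w : slit A v ->
  fundamental_tensor F v (vec v) w = F v * derive1 (ray F v w) 0.
Proof.
move=> Av; have nr := near_ray v w Av; set f := ray F v w.
have df0 : is_derive (0 : R) 1 f (derive1 f 0).
  by have [_ df _] := nbhs_singleton nr; exact: derivable1_is_derive df.
pose C := 2 * F v * derive1 f 0.
have inner : \forall t \near (0 : R), derive1 (fun s =>
    F (Tangent (base v) (vec v + t *: vec v + s *: w)) ^+ 2) 0 = (t + 1) * C.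
  have nt : \forall t \near (0 : R), 0 < t + 1.
    apply: (filterS _ (nbhsx_ballx (0 : R) 1 ltr01)) => t.
    by rewrite -ball_normE /= sub0r normrN ltr_norml => /andP[+ _]; lra.
  apply: filterS nt => t t0; have t0' : t + 1 != 0 by rewrite gt_eqF.
  have E : {near 0, (fun s => F (Tangent (base v) (vec v + t *: vec v + s *: w)) ^+ 2)
      =1 (fun s : R => (t + 1) ^+ 2 * (f (s * (t + 1)^-1) ^+ 2))}.
    have := near0_mulr _ (t + 1)^-1 _ nr; apply: filterS => s [[As _] _ _].
    rewrite -exprMn -(cpf_homog hF As t0); congr (F _ ^+ 2).
    rewrite /tangent_scale /= scalerDr scalerA mulrCA divff// mulr1.
    by rewrite scalerDl scale1r [t *: _ + _]addrC.
  rewrite (near_eq_derive1 _ _ _ _ E); apply: is_derive1_eq.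
  have d1 : is_derive (0 : R) 1 (fun s : R => f (s * (t + 1)^-1)) ((t + 1)^-1 * derive1 f 0).
    by apply: is_derive_scale1; rewrite mul0r.
  have := is_deriveZ ((t + 1) ^+ 2) (is_deriveX 2 d1); move=> /is_derive_eq; apply.
  rewrite /GRing.scale /= mul0r /f ray0 /C; by field.
rewrite /fundamental_tensor (near_eq_derive1 _ _ _ _ inner).
have -> : derive1 (fun t => (t + 1) * C) 0 = C.
  apply: is_derive1_eq.
  have d1 : is_derive (0 : R) 1 (fun t : R => t + 1) 1.
    have := is_deriveD (is_derive_id (0 : R) 1) (is_derive_cst (1 : R) (0 : R) 1).
    by rewrite addr0.
  have := is_deriveM d1 (is_derive_cst C (0 : R) 1); move=> /is_derive_eq; apply.
  by rewrite /GRing.scale /= /cst; ring.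
by rewrite /C; field.
Qed.

Lemma angular_metricE v w : slit A v ->
  angular_metric F v w = F v * derive1 (derive1 (ray F v w)) 0.
Proof.
move=> Av; have F0 : F v != 0 by rewrite gt_eqF// (cpf_gt0 _ _ _ _ _ _ hF).
rewrite /angular_metric fundamental_tensor_diagE// fundamental_tensor_radial//.
by field.
Qed.

(** Covers the vector excluded from the positivity hypothesis, so that positive definiteness yields
    g_v(u, u) >= 0 for every u. *)
Lemma fundamental_tensor0 v : fundamental_tensor F v 0 0 = 0.
Proof.
rewrite fundamental_tensor_diag (_ : (fun r => _) = cst (F v ^+ 2)); last first.
  by apply/funext => r; rewrite -(ray0 F v 0) /ray !scaler0.
have -> : derive1 (cst (F v ^+ 2) : R -> R) = cst 0.
  by apply/funext => r; rewrite derive1_cst.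
by rewrite derive1_cst mulr0.
Qed.

(* The angular metric is the fundamental tensor on the [g_v]-orthogonal
   projection of [w] along [v]. *)
Lemma angular_metric_proj v w (l := derive1 (ray F v w) 0 / F v) : slit A v ->
  angular_metric F v w = fundamental_tensor F v (w - l *: vec v) (w - l *: vec v).
Proof.
move=> Av; have F0 : F v != 0 by rewrite gt_eqF// (cpf_gt0 _ _ _ _ _ _ hF).
set w' := w - _; rewrite (angular_metricE v w Av) (fundamental_tensor_diagE v w' Av).
set f := ray F v w; have nr := near_ray v w Av.
pose k r := (1 - l * r) * f (r / (1 - l * r)).
have nt : \forall r \near (0 : R), 0 < 1 - l * r.
  have nb : nbhs (0 : R) [set r | r < 1].
    by apply: open_nbhs_nbhs; split; [exact: open_lt|rewrite /= ltr01].
  by have := near0_mulr _ l _ nb; apply: filterS => r /=; rewrite subr_gt0 mulrC.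
have nr' : \forall r \near (0 : R), slit A (Tangent (base v) (vec v + (r / (1 - l * r)) *: w)).
  have crho : {for 0, continuous (fun r : R => r / (1 - l * r))}.
    apply: cvgM; first exact: cvg_id.
    apply: cvgV; first by rewrite mulr0 subr0 oner_neq0.
    by apply: cvgB; [exact: cvg_cst|apply: cvgMr; exact: cvg_id].
  have nr1 : nbhs (0 : R) [set r | slit A (Tangent (base v) (vec v + r *: w))].
    by apply: filterS nr => r [].
  have nr2 : nbhs (0 / (1 - l * 0)) [set r | slit A (Tangent (base v) (vec v + r *: w))].
    by rewrite mul0r.
  exact: crho _ nr2.
(* v + r (w - l v) = (1 - l r) (v + (r / (1 - l r)) w), and the positive factor 1 - l r comes out by
   homogeneity. *)
have kE : {near (0 : R), ray F v w' =1 k}.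
  apply: filterS2 nt nr' => r r0 [Ar _]; rewrite /k /f -(cpf_homog hF Ar r0).
  rewrite /ray /tangent_scale /=; congr (F (Tangent _ _)).
  rewrite /w' scalerBr scalerA [RHS]scalerDr scalerA [(_ - _) * _]mulrCA.
  rewrite divff ?gt_eqF// mulr1 scalerBl scale1r [l * r]mulrC.
  by rewrite [RHS]addrAC addrA.
rewrite (near_eq_derive1 _ _ _ _ kE) (near_eq_derive1 _ _ _ _ (near_eq_derive1_near _ _ _ _ kE)).
have df : \forall r \near (0 : R), derivable f r 1 by apply: filterS nr => r [].
have ddf : derivable (derive1 f) 0 1 by have [] := nbhs_singleton nr.
have [-> ->] := perspective_derive _ f l df ddf.
(* The choice of [l] makes the first derivative f'(0) - l F(v) vanish, so only F(v) f''(0)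
   remains. *)
by rewrite /f ray0 -/f /l divfK// subrr expr0n add0r.
Qed.

End fundamental_tensor_rays.

(** * The formula for g and its positive definiteness *)

Lemma derivable_sqr (R : realType) (phi : R -> R) (I : set R) : open I ->
  (forall (k : nat) (s : R), I s -> derivable (derive1n k phi) s 1) ->
  forall s, I s -> derivable (fun s => phi s ^+ 2) s 1 /\
    derivable (derive1 (fun s => phi s ^+ 2)) s 1.
Proof.
move=> oI dphi s Is.
have d0 x : I x -> is_derive x 1 phi (derive1 phi x).
  by move=> Ix; apply: derivable1_is_derive; exact: (dphi 0%N).
have dsqr x : I x -> is_derive x 1 (fun s => phi s ^+ 2) (2 * phi x * derive1 phi x).
  by move=> /d0 d; apply: is_derive_eq (is_deriveX 2 d) _; rewrite /= expr1.
split; first by have := dsqr s Is => h; exact: ex_derive.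
(* The formula for the derivative holds on a whole neighbourhood of [s], as a second differentiation
   requires. *)
have E : {near s, (fun x => 2 * phi x * derive1 phi x) =1 derive1 (fun s => phi s ^+ 2)}.
  apply: filterS (open_nbhs_nbhs (conj oI Is)) => x /dsqr h.
  by rewrite (is_derive1_eq _ _ _ _ h).
apply: near_eq_derivable E _.
have d1 := derivable1_is_derive _ _ _ (dphi 1%N s Is).
have h := is_deriveM (is_deriveZ 2 (d0 s Is)) d1.
exact: ex_derive.
Qed.

Section phi_metric_fundamental_tensor.
Context (R : realType) (n : nat) (M : smooth_manifold R n).
Context (A0 : set (tangent_bundle M)) (F1 F2 : tangent_bundle M -> R).
Context (I : set R) (phi : R -> R).
Hypotheses (hF1 : conic_pseudo_finsler A0 F1) (hF2 : conic_pseudo_finsler A0 F2).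
Hypotheses (hI : open I)
  (phi_smooth : forall (k : nat) (s : R), I s -> derivable (derive1n k phi) s 1)
  (phi_gt0 : forall s, I s -> 0 < phi s)
  (hA : @base R n M @` phi_domain A0 F1 F2 I = setT).
Let psi (s : R) : R := phi s ^+ 2.
Let varphi1 s := 2 * psi s - s * derive1 psi s.
Let varphi2 s := 2 * psi s * derive1n 2 psi s - derive1 psi s ^+ 2.
Let A := phi_domain A0 F1 F2 I.
Let F := phi_metric F1 F2 phi.

(** Near 0 the squared ray of [F] is f1^2 psi(f2 / f1). In its second derivative f1'' and f2'' give
    the two angular terms, and the remaining quadratic form in f1'(0), f2'(0) splits into the two
    squares. *)
Lemma fundamental_tensor_phi_metric v (w : 'rV[R]_n) (s := F2 v / F1 v) : slit A v ->
  2 * fundamental_tensor F v w w =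
    varphi1 s * angular_metric F1 v w
    + F1 v / F2 v * derive1 psi s * angular_metric F2 v w
    + varphi2 s / (2 * psi s)
      * (F2 v / F1 v ^+ 2 * fundamental_tensor F1 v (vec v) w
         - fundamental_tensor F2 v (vec v) w / F2 v) ^+ 2
    + 1 / (2 * psi s)
      * (varphi1 s * (fundamental_tensor F1 v (vec v) w / F1 v)
         + derive1 psi s * (fundamental_tensor F2 v (vec v) w / F2 v)) ^+ 2.
Proof.
move=> Av.
have hF : conic_pseudo_finsler A F by exact: phi_metric_conic_pseudo_finsler.
have BE : slit A = [set v | slit A0 v /\ I (F2 v / F1 v)] by exact: slit_phi_domain.
have [A0v Is] : slit A0 v /\ I (F2 v / F1 v) by move: Av; rewrite BE.
have nr := near_ray _ _ _ _ _ hF v w Av.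
have nr1 := near_ray _ _ _ _ _ hF1 v w A0v.
have nr2 := near_ray _ _ _ _ _ hF2 v w A0v.
have E : {near (0 : R), (fun r => ray _ _ _ F v w r ^+ 2) =1
    (fun r => ray _ _ _ F1 v w r ^+ 2 * psi (ray _ _ _ F2 v w r / ray _ _ _ F1 v w r))}.
  apply: filterS nr => r [Ar _ _]; rewrite BE in Ar.
  by rewrite /ray [F _](phi_metricE _ _ _ _ _ _ _ _ _ Ar) exprMn.
rewrite (angular_metricE _ _ _ _ _ hF1 v w A0v) (angular_metricE _ _ _ _ _ hF2 v w A0v).
rewrite (fundamental_tensor_radial _ _ _ _ _ hF1 v w A0v).
rewrite (fundamental_tensor_radial _ _ _ _ _ hF2 v w A0v).
rewrite fundamental_tensor_diag mulVKf; last by rewrite pnatr_eq0.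
rewrite (near_eq_derive1 _ _ _ _ (near_eq_derive1_near _ _ _ _ E)).
have dpsi := derivable_sqr _ _ _ hI phi_smooth.
have [_ _ ddf1] := nbhs_singleton nr1; have [_ _ ddf2] := nbhs_singleton nr2.
have nf : \forall r \near (0 : R), [/\ ray _ _ _ F1 v w r != 0,
    I (ray _ _ _ F2 v w r / ray _ _ _ F1 v w r),
    derivable (ray _ _ _ F1 v w) r 1 & derivable (ray _ _ _ F2 v w) r 1].
  apply: filterS3 nr nr1 nr2 => r [Ar _ _] [A0r d1 _] [_ d2 _]; split=> //.
    by rewrite gt_eqF// /ray (cpf_gt0 _ _ _ _ _ _ hF1).
  by move: Ar; rewrite BE => -[].
rewrite (derive2_square_profile _ _ _ psi I hI (fun x Ix => (dpsi x Ix).1)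
  (fun x Ix => (dpsi x Ix).2) nf ddf1 ddf2).
have psi0 : psi s != 0 by rewrite gt_eqF// /psi exprn_gt0// phi_gt0.
have F10 : F1 v != 0 by rewrite gt_eqF// (cpf_gt0 _ _ _ _ _ _ hF1).
have F20 : F2 v != 0 by rewrite gt_eqF// (cpf_gt0 _ _ _ _ _ _ hF2).
rewrite !ray0 -/s /varphi1 /varphi2 /derive1n /=.
(* Eliminating [F2 v] leaves independent variables; the claim becomes a rational identity whose
   denominators involve only [s], [F1 v] and [psi s]. *)
have F2E : F2 v = s * F1 v by rewrite /s divfK.
have s0 : s != 0 by rewrite /s mulf_neq0// invr_eq0.
rewrite F2E; move: (derive1 (derive1 psi) s) (derive1 psi s) (psi s) psi0.
move: s s0 {F20 F2E}; move: (F1 v) F10.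
move: (derive1 (derive1 (ray _ _ _ F1 v w)) 0) (derive1 (derive1 (ray _ _ _ F2 v w)) 0).
move: (derive1 (ray _ _ _ F1 v w) 0) (derive1 (ray _ _ _ F2 v w) 0).
move=> b1 b2 c1 c2 a a0 s s0 p2 p1 p p0; field.
exact/and3P.
Qed.

Lemma phi_metric_posdef v (w : 'rV[R]_n) :
  (forall v, slit A0 v -> forall w : 'rV[R]_n, w != 0 -> 0 < fundamental_tensor F1 v w w) ->
  (forall v, slit A0 v -> forall w : 'rV[R]_n, w != 0 -> 0 < fundamental_tensor F2 v w w) ->
  (forall s, I s -> [/\ 0 <= derive1 psi s, 0 < varphi1 s & 0 <= varphi2 s]) ->
  slit A v -> w != 0 -> 0 < fundamental_tensor F v w w.
Proof.
move=> pos1 pos2 hpsi Av w0; have [A0v Is] : slit A0 v /\ I (F2 v / F1 v).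
  by have := Av; rewrite /A slit_phi_domain.
have F10 : 0 < F1 v by exact: (cpf_gt0 _ _ _ _ _ _ hF1).
have F20 : 0 < F2 v by exact: (cpf_gt0 _ _ _ _ _ _ hF2).
rewrite -(pmulr_rgt0 _ (@ltr0Sn R 1)) (fundamental_tensor_phi_metric v w Av).
set s := F2 v / F1 v; have [psi'0 p10 p20] := hpsi s Is.
have psi0 : 0 < psi s by rewrite /psi exprn_gt0// phi_gt0.
have ge0 (G : tangent_bundle M -> R) u : slit A0 v ->
    (forall v, slit A0 v -> forall w : 'rV[R]_n, w != 0 -> 0 < fundamental_tensor G v w w) ->
    0 <= fundamental_tensor G v u u.
  move=> A0v' pos; have [->|/(pos v A0v')/ltW//] := eqVneq u 0.
  by rewrite fundamental_tensor0.
have h20 : 0 <= angular_metric F2 v w.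
  by rewrite (angular_metric_proj _ _ _ _ _ hF2 v w A0v); exact: ge0.
have t2 : 0 <= F1 v / F2 v * derive1 psi s * angular_metric F2 v w.
  by rewrite mulr_ge0// mulr_ge0// divr_ge0// ltW.
have t3 x : 0 <= varphi2 s / (2 * psi s) * x ^+ 2.
  by rewrite mulr_ge0 ?sqr_ge0// divr_ge0// mulr_ge0// ltW.
have p0 : 0 < 1 / (2 * psi s) by rewrite divr_gt0// mulr_gt0.
pose l := derive1 (ray _ _ _ F1 v w) 0 / F1 v.
(* If w is not l v, the first summand is positive by [angular_metric_proj]; if w = l v, positivity
   must come from the last square. *)
have [/subr0_eq wE|wNv] := eqVneq (w - l *: vec v) 0; last first.
  have h10 : 0 < angular_metric F1 v w.
    by rewrite (angular_metric_proj _ _ _ _ _ hF1 v w A0v); exact: pos1 v A0v _ wNv.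
  apply: (ltr_wpDr (mulr_ge0 (ltW p0) (sqr_ge0 _))); apply: (ltr_wpDr (t3 _)).
  exact: (ltr_wpDr t2 (mulr_gt0 p10 h10)).
have l0 : l != 0 by apply: contra_neq w0 => l0; rewrite wE l0 scale0r.
(* From here on only w = l v matters, so one computation serves [F1] and [F2]: the ray is (1 + r l)
   G(v), with derivative l G(v). *)
clearbody l; have radial (G : tangent_bundle M -> R) : conic_pseudo_finsler A0 G ->
    fundamental_tensor G v (vec v) w / G v = l * G v.
  move=> hG; have G0 := cpf_gt0 _ _ _ _ _ _ hG A0v.
  rewrite (fundamental_tensor_radial _ _ _ _ _ hG v w A0v) mulrAC divff ?gt_eqF// mul1r.
  have nl : \forall r \near (0 : R), 0 < r * l + 1.
    have nb : nbhs (0 : R) [set r | -1 < r].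
      by apply: open_nbhs_nbhs; split; [exact: open_gt|rewrite /= ltrN10].
    by have := near0_mulr _ l _ nb; apply: filterS => r /=; rewrite -subr_gt0 opprK.
  have E : {near (0 : R), ray _ _ _ G v w =1 (fun r => (r * l + 1) * G v)}.
    apply: filterS nl => r r0; rewrite -(cpf_homog hG A0v.1 r0) /ray wE.
    by rewrite /tangent_scale scalerA scalerDl scale1r addrC.
  rewrite (near_eq_derive1 _ _ _ _ E); apply: is_derive1_eq.
  have d1 : is_derive (0 : R) 1 (fun r : R => r + 1) 1.
    have := is_deriveD (is_derive_id (0 : R) 1) (is_derive_cst (1 : R) (0 : R) 1).
    by rewrite addr0.
  have := is_deriveM (is_deriveD (is_deriveM (is_derive_id (0 : R) 1)
    (is_derive_cst l (0 : R) 1)) (is_derive_cst (1 : R) (0 : R) 1)) (is_derive_cst (G v) (0 : R) 1).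
  move=> /is_derive_eq; apply; rewrite /GRing.scale /= /cst; ring.
have h10 : 0 <= angular_metric F1 v w.
  by rewrite (angular_metric_proj _ _ _ _ _ hF1 v w A0v); exact: ge0.
(* The square equals l^2 (varphi1 F1 + psi' F2)^2, where l is nonzero and the bracket is positive by
   the sign conditions. *)
have pos a b : a = l * F1 v -> b = l * F2 v ->
    0 < (varphi1 s * a + derive1 psi s * b) ^+ 2.
  move=> -> ->; rewrite [varphi1 s * _]mulrCA [derive1 psi s * _]mulrCA -mulrDr exprMn.
  have l2 : 0 < l ^+ 2 by rewrite lt_neqAle sqr_ge0 eq_sym expf_neq0.
  apply: (mulr_gt0 l2); apply: exprn_gt0.
  exact: (ltr_wpDr (mulr_ge0 psi'0 (ltW F20)) (mulr_gt0 p10 F10)).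
apply: ltr_wpDl; first exact: (addr_ge0 (addr_ge0 (mulr_ge0 (ltW p10) h10) t2) (t3 _)).
exact: mulr_gt0 p0 (pos _ _ (radial F1 hF1) (radial F2 hF2)).
Qed.

End phi_metric_fundamental_tensor.

Theorem proposition4p18 (R : realType) (n : nat) (M : smooth_manifold R n)
    (A0 : set (tangent_bundle M)) (F1 F2 : tangent_bundle M -> R)
    (I : set R) (phi : R -> R)
    (hF1 : conic_finsler A0 F1) (hF2 : conic_finsler A0 F2)
    (hI : open I)
    (phi_smooth : forall (k : nat) (s : R), I s -> derivable (derive1n k phi) s 1)
    (phi_gt0 : forall s, I s -> 0 < phi s)
    (hA : @base R n M @` phi_domain A0 F1 F2 I = setT) :
  let psi := fun s : R => phi s ^+ 2 in
  let varphi1 := fun s : R => 2 * psi s - s * derive1 psi s in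
  let varphi2 := fun s : R => 2 * psi s * derive1n 2 psi s - derive1 psi s ^+ 2 in
  let A := phi_domain A0 F1 F2 I in
  let F := phi_metric F1 F2 phi in
  let g1 := fundamental_tensor F1 in
  let g2 := fundamental_tensor F2 in
  let g := fundamental_tensor F in
  let h1 := angular_metric F1 in
  let h2 := angular_metric F2 in
  [/\ conic_pseudo_finsler A F,
      (forall (v : tangent_bundle M) (w : 'rV[R]_n), slit A v ->
        let s := F2 v / F1 v in
        2 * g v w w =
          varphi1 s * h1 v w
          + F1 v / F2 v * derive1 psi s * h2 v w
          + varphi2 s / (2 * psi s)
            * (F2 v / F1 v ^+ 2 * g1 v (vec v) w
               - g2 v (vec v) w / F2 v) ^+ 2
          + 1 / (2 * psi s)
            * (varphi1 s * (g1 v (vec v) w / F1 v)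
               + derive1 psi s * (g2 v (vec v) w / F2 v)) ^+ 2)
    & (forall s, I s ->
        [/\ 0 <= derive1 psi s, 0 < varphi1 s & 0 <= varphi2 s]) ->
      conic_finsler A F].
Proof.
have cF1 := cf_pseudo hF1; have cF2 := cf_pseudo hF2.
move=> psi varphi1 varphi2 A F g1 g2 g h1 h2.
have hF : conic_pseudo_finsler A F by exact: phi_metric_conic_pseudo_finsler.
split => //; first by move=> v w Av; exact: (fundamental_tensor_phi_metric R n M A0 F1 F2 I phi
  cF1 cF2 hI phi_smooth phi_gt0 hA v w Av).
move=> hpsi; split => // v Av w w0.
exact: (phi_metric_posdef R n M A0 F1 F2 I phi cF1 cF2 hI phi_smooth phi_gt0 hA v w
  (cf_posdef hF1) (cf_posdef hF2) hpsi Av w0).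
Qed.
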